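(* Let $\tilde{\mathcal X}^J_1=\{(x,y,q,p,\kappa)\in\mathbb R^5: y>0\}$ carry the almost cosymplectic structure $(\theta,\omega)$ with $$\theta=\sqrt\delta\,(d\kappa-p\,dq+q\,dp),\qquad \omega=\frac{k}{y^2}\,dx\wedge dy+2\nu\, dq\wedge dp ,$$ where $\delta>0$ and $k,\nu$ are nonzero real constants; $d\omega=0$, so it is a generalized transitive almost cosymplectic manifold. Let $a,b,c,\mathrm m,\mathrm n\in\mathbb R$ and let $$\mathcal H=\mathcal H(q,p)+\mathcal H(x,y)+\mathcal H(\kappa),$$ $$\mathcal H(q,p)=\nu\big[(\mathrm m+c)q^2+(c-\mathrm m)p^2+2\mathrm n\,qp+2(aq+bp)\big],$$ $$\mathcal H(x,y)=\frac{k}{y}\big[(\mathrm m+c)(x^2+y^2)-2\mathrm n\,x+c-\mathrm m\big],$$ where $\mathcal H(\kappa)$ is a smooth function of $\kappa$ only. Consider the equations of motion of $\mathcal H$ on this almost cosymplectic manifold (as defined in the context), in the coordinates $Q_1=kx$, $P_1=-1/y$, $Q_2=2\nu q$, $P_2=p$, $\kappa$, and write them as $\dot Q_I=A_I$, $\dot P_I=B_I$ ($I=1,2$), $\dot\kappa=C$. Then $$A_1=y^2\frac{\partial\mathcal H}{\partial y},\qquad A_2=\frac{\partial\mathcal H}{\partial p}-q\frac{\partial\mathcal H}{\partial\kappa},$$ $$B_1=-\frac1k\frac{\partial\mathcal H}{\partial x},\qquad B_2=-\frac1{2\nu}\Big(\frac{\partial\mathcal H}{\partial q}+p\frac{\partial\mathcal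 H}{\partial\kappa}\Big),$$ $$C=\frac1{2\nu}\Big(p\frac{\partial\mathcal H}{\partial p}+q\frac{\partial\mathcal H}{\partial q}\Big)-\mathcal H ,$$ and the equations of motion reduce to $$\dot x=\frac{y^2}{k}\frac{\partial\mathcal H}{\partial y},\quad \dot y=-\frac{y^2}{k}\frac{\partial\mathcal H}{\partial x},\quad \dot q=\frac1{2\nu}\Big(\frac{\partial\mathcal H}{\partial p}-q\frac{\partial\mathcal H}{\partial\kappa}\Big),\quad \dot p=-\frac1{2\nu}\Big(\frac{\partial\mathcal H}{\partial q}+p\frac{\partial\mathcal H}{\partial\kappa}\Big),$$ $$\dot\kappa=\frac1{2\nu}\Big(p\frac{\partial\mathcal H}{\partial p}+q\frac{\partial\mathcal H}{\partial q}\Big)-\mathcal H .$$ Explicitly, the equations of motion on $\tilde{\mathcal X}^J_1$ are $$\dot x=(\mathrm m+c)(y^2-x^2)+2\mathrm n\,x+\mathrm m-c,$$ $$\dot y=-2y\big[(\mathrm m+c)x-\mathrm n\big],$$ $$\dot q=(c-\mathrm m)p+\mathrm n\,q+b-\frac{q}{2\nu}\frac{\partial\mathcal H}{\partial\kappa},$$ $$\dot p=-\big[(\mathrm m+c)q+\mathrm n\,p+a\big]-\frac{p}{2\nu}\frac{\partial\mathcal H}{\partial\kappa},$$ $$\dot\kappa=(c-\mathrm m)p^2+(c+\mathrm m)q^2+2\mathrm n\,pq+pb+aq-\mathcal H .$$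
   Context: An almost cosymplectic (ACOS) manifold is a triplet $(M,\theta,\omega)$ with $\dim M=2N+1$, $\theta$ a 1-form and $\omega$ a 2-form of rank $2N$ such that $\theta\wedge\omega^N\neq0$ everywhere. It is called generalized transitive almost cosymplectic (GTACOS) if moreover $d\omega=0$. Equations of motion. Suppose $M$ has coordinates $(Q_1,\dots,Q_N,P_1,\dots,P_N,\kappa)$ in which $\omega=\sum_I dQ_I\wedge dP_I$ and $\theta=\sum_I(a_I\,dQ_I+b_I\,dP_I)+c_0\,d\kappa$ with $c_0\neq0$. Let $R=\frac1{c_0}\frac{\partial}{\partial\kappa}$ be the Reeb vector field. The equations of motion of $\mathcal H\in C^\infty(M)$ are by definition $$\dot Q_I=\frac{\partial\mathcal H}{\partial P_I}-b_IR(\mathcal H),\quad \dot P_I=-\frac{\partial\mathcal H}{\partial Q_I}+a_IR(\mathcal H),\quad \dot\kappa=\frac1{c_0}\sum_I\Big(-a_I\frac{\partial\mathcal H}{\partial P_I}+b_I\frac{\partial\mathcal H}{\partial Q_I}\Big)-\mathcal H,$$ for $I=1,\dots,N$. For $\tilde{\mathcal X}^J_1$ (the extended Siegel-Jacobi upper half-plane) one has $N=2$, and with $Q_1=kx$, $P_1=-1/y$, $Q_2=2\nu q$, $P_2=p$ the coefficients are $c_0=\sqrt\delta$, $a_1=b_1=0$, $a_2=-\frac{\sqrt\delta}{2\nu}p$, $b_2=\sqrt\delta\,q$. The function $\mathcal H$ is the energy function attached to a Hamiltonian linear in the generators of the Jacobi group, with coefficients $\epsilon_a=a+\mathrm i b$,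 $\bar\epsilon_+=\epsilon_-=\mathrm m+\mathrm i\mathrm n$, $\epsilon_0=2c$. Only the explicit expression for $\mathcal H$ in the claim is needed. The real parameter $c$ there is unrelated to the coefficient $c_0$ of $d\kappa$ in $\theta$. *)

(* Defs.v *)
From HB Require Import structures.
From mathcomp Require Import all_boot all_order all_algebra all_fingroup.
From mathcomp Require Import all_classical all_reals all_analysis.
Import Order.TTheory GRing.Theory Num.Theory.
Import numFieldNormedType.Exports.

Set Implicit Arguments.
Unset Strict Implicit.
Unset Printing Implicit Defensive.

Local Open Scope classical_set_scope.
Local Open Scope ring_scope.

(* f is C^m on the open set U: all iterated directional derivatives up to
   order m exist, f and those of order < m being Frechet differentiable. *)
Fixpoint Cdiff (R : realType) (V : normedModType R) (m : nat) (U : set V)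
    (f : V -> R^o) : Prop :=
  match m with
  | 0 => forall z, U z -> {for z, continuous f}
  | m'.+1 => (forall z, U z -> differentiable f z) /\
             (forall v, Cdiff m' U ('D_v f))
  end.

Definition smooth (R : realType) (V : normedModType R) (U : set V)
    (f : V -> R^o) : Prop := forall m, Cdiff m U f.

(* A differential j-form on an open subset of R^n: at each point, a function of
   j vectors, given as the rows of a j x n matrix. *)
Definition form (R : realType) (n j : nat) : Type :=
  'rV[R]_n -> 'M[R]_(j, n) -> R.

Definition multilinear (R : realType) (n j : nat) (u : 'M[R]_(j, n) -> R) :=
  forall (i : 'I_j) (A B C : 'M[R]_(j, n)) (b c : R),
    row i A = b *: row i B + c *: row i C ->
    row' i B = row' i A -> row' i C = row' i A -> u A = b * u B + c * u C.

Definition alternating (R : realType) (n j : nat) (u : 'M[R]_(j, n) -> R) :=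
  forall (A : 'M[R]_(j, n)) (i1 i2 : 'I_j),
    i1 != i2 -> row i1 A = row i2 A -> u A = 0.

Definition diff_form (R : realType) (n j : nat) (M : set 'rV[R]_n)
    (w : form R n j) : Prop :=
  (forall z, M z -> multilinear (w z) /\ alternating (w z)) /\
  (forall v, smooth M (fun z => w z v)).

(* Normalized so that (df /\ dg)(u, v) = df(u) dg(v) - df(v) dg(u). *)
Definition wedge (R : realType) (n j l : nat) (u : form R n j) (w : form R n l)
    : form R n (j + l) :=
  fun z v => ((j`! * l`!)%:R)^-1 *
    \sum_(s : 'S_(j + l)) (-1) ^+ s *
       u z (usubmx (row_perm s v)) * w z (dsubmx (row_perm s v)).

Fixpoint wedge_pow (R : realType) (n : nat) (w : form R n 2) (m : nat)
    : form R n m.*2 :=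
  match m with
  | 0 => fun _ _ => 1
  | m'.+1 => wedge w (@wedge_pow R n w m')
  end.
Arguments wedge_pow {R n} w m.

(* Exterior derivative, evaluated on constant vector fields. *)
Definition ext_d (R : realType) (n j : nat) (w : form R n j) : form R n j.+1 :=
  fun z v => \sum_(i < j.+1)
    (-1) ^+ i * 'D_(row i v) (fun z' => w z' (row' i v) : R^o) z.

Definition dfun (R : realType) (n : nat) (f : 'rV[R]_n -> R) : form R n 1 :=
  ext_d (fun z (_ : 'M[R]_(0, n)) => f z).

Definition form_rank (R : realType) (n : nat) (w : form R n 2) (z : 'rV[R]_n) :=
  \rank (\matrix_(i < n, j < n) w z (\matrix_(l < 2) delta_mx 0 (if l == 0 then i else j))).

Definition acos (R : realType) (N : nat) (M : set 'rV[R]_(N + N + 1))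
    (theta : form R (N + N + 1) 1) (omega : form R (N + N + 1) 2) : Prop :=
  [/\ open M, diff_form M theta, diff_form M omega,
      (forall z, M z -> form_rank omega z = N.*2) &
      (forall z, M z -> exists v, wedge theta (wedge_pow omega N) z v != 0)].

Definition gtacos (R : realType) (N : nat) (M : set 'rV[R]_(N + N + 1))
    (theta : form R (N + N + 1) 1) (omega : form R (N + N + 1) 2) : Prop :=
  acos M theta omega /\ (forall z v, M z -> ext_d omega z v = 0).

(* phi is a global chart of M, with inverse psi. *)
Definition coordinates (R : realType) (n : nat) (M : set 'rV[R]_n)
    (phi psi : 'rV[R]_n -> 'rV[R]_n) : Prop :=
  [/\ open (phi @` M), (forall z, M z -> psi (phi z) = z),
      (forall i, smooth M (fun z => phi z 0 i)) &
      (forall i, smooth (phi @` M) (fun z => psi z 0 i))].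

Definition pd (R : realType) (n : nat) (i : 'I_n) (f : 'rV[R]_n -> R)
    (z : 'rV[R]_n) : R := 'D_(delta_mx 0 i) (f : 'rV[R]_n -> R^o) z.

Definition chart_pd (R : realType) (n : nat) (phi psi : 'rV[R]_n -> 'rV[R]_n)
    (i : 'I_n) (f : 'rV[R]_n -> R) (z : 'rV[R]_n) : R :=
  pd i (f \o psi) (phi z).

(* Positions of Q_I, P_I, kappa in (Q_1, ..., Q_N, P_1, ..., P_N, kappa). *)
Definition iQ (N : nat) (I : 'I_N) : 'I_(N + N + 1) := lshift 1 (lshift N I).
Definition iP (N : nat) (I : 'I_N) : 'I_(N + N + 1) := lshift 1 (rshift N I).
Definition iK (N : nat) : 'I_(N + N + 1) := rshift (N + N) ord0.

Definition coord (R : realType) (n : nat) (phi : 'rV[R]_n -> 'rV[R]_n)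
    (i : 'I_n) : 'rV[R]_n -> R := fun z => phi z 0 i.

(* omega = sum_I dQ_I /\ dP_I and theta = sum_I (a_I dQ_I + b_I dP_I) +
   c0 dkappa in the chart phi. *)
Definition adapted (R : realType) (N : nat) (M : set 'rV[R]_(N + N + 1))
    (theta : form R (N + N + 1) 1) (omega : form R (N + N + 1) 2)
    (phi : 'rV[R]_(N + N + 1) -> 'rV[R]_(N + N + 1))
    (ca cb : 'I_N -> 'rV[R]_(N + N + 1) -> R) (c0 : 'rV[R]_(N + N + 1) -> R) :=
  forall z, M z ->
  [/\ c0 z != 0,
      (forall v, omega z v =
         \sum_(I < N) wedge (dfun (coord phi (iQ I)))
                            (dfun (coord phi (iP I))) z v) &
      (forall v, theta z v =
         \sum_(I < N) (ca I z * dfun (coord phi (iQ I)) z v +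
                       cb I z * dfun (coord phi (iP I)) z v)
         + c0 z * dfun (coord phi (iK N)) z v)].

Section EquationsOfMotion.
Variables (R : realType) (N : nat).
Let V := 'rV[R]_(N + N + 1).
Variables (phi psi : V -> V) (ca cb : 'I_N -> V -> R) (c0 : V -> R).

Definition reeb (f : V -> R) : V -> R :=
  fun z => (c0 z)^-1 * chart_pd phi psi (iK N) f z.

(* Right-hand sides of the equations for Q_I, P_I, kappa. *)
Definition eomQ (H : V -> R) (I : 'I_N) : V -> R := fun z =>
  chart_pd phi psi (iP I) H z - cb I z * reeb H z.

Definition eomP (H : V -> R) (I : 'I_N) : V -> R := fun z =>
  - chart_pd phi psi (iQ I) H z + ca I z * reeb H z.

Definition eomK (H : V -> R) : V -> R := fun z =>
  (c0 z)^-1 * (\sum_(I < N) (- ca I z * chart_pd phi psi (iP I) H z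
                             + cb I z * chart_pd phi psi (iQ I) H z)) - H z.

End EquationsOfMotion.

(* f' = F holds along the curve g at all times t in J. *)
Definition dot (R : realType) (n : nat) (J : set R) (g : R -> 'rV[R]_n)
    (f F : 'rV[R]_n -> R) : Prop :=
  forall t, J t -> is_derive (t : R^o) 1 (f \o g : R^o -> R^o) (F (g t)).

Definition motion (R : realType) (N : nat)
    (phi psi : 'rV[R]_(N + N + 1) -> 'rV[R]_(N + N + 1))
    (ca cb : 'I_N -> 'rV[R]_(N + N + 1) -> R) (c0 : 'rV[R]_(N + N + 1) -> R)
    (H : 'rV[R]_(N + N + 1) -> R) (J : set R) (g : R -> 'rV[R]_(N + N + 1)) :=
  [/\ (forall I : 'I_N, dot J g (coord phi (iQ I)) (eomQ phi psi cb c0 H I)),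
      (forall I : 'I_N, dot J g (coord phi (iP I)) (eomP phi psi ca c0 H I)) &
      dot J g (coord phi (iK N)) (eomK phi psi ca cb c0 H)].

(* The extended Siegel-Jacobi upper half-plane, with R^5 coordinates ordered
   (x, y, q, p, kappa). *)
Definition ix : 'I_(2 + 2 + 1) := @Ordinal 5 0 isT.
Definition iy : 'I_(2 + 2 + 1) := @Ordinal 5 1 isT.
Definition iq : 'I_(2 + 2 + 1) := @Ordinal 5 2 isT.
Definition ip : 'I_(2 + 2 + 1) := @Ordinal 5 3 isT.
Definition ik : 'I_(2 + 2 + 1) := @Ordinal 5 4 isT.

Section SiegelJacobi.
Variable R : realType.
Let V := 'rV[R]_(2 + 2 + 1).

Definition xc : V -> R := fun z => z 0 ix.
Definition yc : V -> R := fun z => z 0 iy.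
Definition qc : V -> R := fun z => z 0 iq.
Definition pc : V -> R := fun z => z 0 ip.
Definition kc : V -> R := fun z => z 0 ik.

Definition XJ1 : set V := [set z | 0 < yc z].

Definition thetaJ (delta : R) : form R (2 + 2 + 1) 1 := fun z v =>
  Num.sqrt delta * (dfun kc z v - pc z * dfun qc z v + qc z * dfun pc z v).

Definition omegaJ (k nu : R) : form R (2 + 2 + 1) 2 := fun z v =>
  k / yc z ^+ 2 * wedge (dfun xc) (dfun yc) z v
  + 2 * nu * wedge (dfun qc) (dfun pc) z v.

(* The chart (Q_1, Q_2, P_1, P_2, kappa) = (k x, 2 nu q, -1/y, p, kappa) and
   its inverse. *)
Definition phiJ (k nu : R) : V -> V := fun z =>
  \row_i [:: k * xc z; 2 * nu * qc z; - (yc z)^-1; pc z; kc z]`_i.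

Definition psiJ (k nu : R) : V -> V := fun w =>
  \row_i [:: w 0 (iQ 0) / k; - (w 0 (iP 0))^-1;
             w 0 (iQ 1) / (2 * nu); w 0 (iP 1); w 0 (iK 2)]`_i.

Definition caJ (delta nu : R) (I : 'I_2) : V -> R := fun z =>
  [:: 0; - (Num.sqrt delta / (2 * nu)) * pc z]`_I.

Definition cbJ (delta : R) (I : 'I_2) : V -> R := fun z =>
  [:: 0; Num.sqrt delta * qc z]`_I.

Definition c0J (delta : R) : V -> R := fun=> Num.sqrt delta.

Definition Hqp (nu a b c m n : R) : V -> R := fun z =>
  nu * ((m + c) * qc z ^+ 2 + (c - m) * pc z ^+ 2 + 2 * n * qc z * pc z
        + 2 * (a * qc z + b * pc z)).

Definition Hxy (k c m n : R) : V -> R := fun z =>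
  k / yc z * ((m + c) * (xc z ^+ 2 + yc z ^+ 2) - 2 * n * xc z + c - m).

Definition energy (k nu a b c m n : R) (h : R -> R) : V -> R := fun z =>
  Hqp nu a b c m n z + Hxy k c m n z + h (kc z).

End SiegelJacobi.

(* Main.v *)
Require Import Defs.
From HB Require Import structures.
From mathcomp Require Import all_boot all_order all_algebra all_fingroup.
From mathcomp Require Import all_classical all_reals all_analysis.
From mathcomp Require Import ring.
Import Order.TTheory GRing.Theory Num.Theory.
Import numFieldNormedType.Exports.

Set Implicit Arguments.
Unset Strict Implicit.
Unset Printing Implicit Defensive.

Local Open Scope classical_set_scope.
Local Open Scope ring_scope.

(** The almost cosymplectic structure is checked in coordinates, where
    theta(v) = sqrt delta (v_kappa - p v_q + q v_p) and
    omega(u, v) = k / y^2 (u_x v_y - v_x u_y) + 2 nu (u_q v_p - v_q u_p)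
    (thetaJE, omegaJE).  The matrix of omega is block diagonal, with two
    invertible 2 x 2 antisymmetric blocks and a zero for kappa, hence of rank 4.
    The only non-constant coefficient of omega is a function of y that
    multiplies dx /\ dy, so dy occurs twice in d omega, which is therefore 0.

    For theta /\ omega^2 one evaluates on the frame d/dkappa, d/dx, d/dy,
    d/dq + p d/dkappa, d/dp - q d/dkappa.  Since theta kills all its members but
    the first, the wedge product reduces to theta(d/dkappa) times omega^2 of the
    other four (wedge_contract); omega^2 of four vectors is twice the Pfaffian
    of their omega-products (wedge_pow2), here (k / y^2) (2 nu).

    For the equations of motion, one chain rule (derive_energy) for the energy
    composed with an arbitrary map X serves twice: with X the identity it gives
    the partial derivatives in (x, y, q, p, kappa), and with X the inverse chart
    it gives those in (Q, P, kappa).  Both are combinations of the same five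
    functions energy_x, ..., energy_k, so the claimed right-hand sides are
    rational identities.  Along a curve, Q_1, Q_2 are constant multiples of x, q
    (dot_scale), and P_1 = - 1 / y can be differentiated in either direction
    because y never vanishes (dot_Ninv). *)

(** * Directional derivatives of scalar functions *)

(** The rules of calculus with explicit products of scalars as values, so that
    the derivative of a composite expression is a term that ring and field can
    normalize. *)
Section ScalarDerivatives.
Variables (R : realType) (V : normedModType R).
Implicit Types (f g : V -> R^o) (z v : V).

Lemma is_derive_ptD f g z v (df dg : R) :
  is_derive z v f df -> is_derive z v g dg ->
  is_derive z v (fun x => f x + g x : R^o) (df + dg).
Proof. by move=> Df Dg; exact: is_deriveD. Qed.

Lemma is_derive_ptM f g z v (df dg : R) :
  is_derive z v f df -> is_derive z v g dg ->
  is_derive z v (fun x => f x * g x : R^o) (f z * dg + g z * df).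
Proof. by move=> Df Dg; exact: (@is_deriveM _ _ f g). Qed.

Lemma is_derive_ptV f z v (df : R) : f z != 0 ->
  is_derive z v f df ->
  is_derive z v (fun x => (f x)^-1 : R^o) (- (f z) ^- 2 * df).
Proof.
move=> fz [Df <-]; apply: DeriveDef; first exact: derivableV.
exact: deriveV.
Qed.

Lemma is_derive_ptC (r : R) z v : is_derive z v (fun=> r : R^o) 0.
Proof. exact: is_derive_cst. Qed.

Lemma is_derive_ptN f z v (df : R) :
  is_derive z v f df -> is_derive z v (fun x => - f x : R^o) (- df).
Proof. by move=> Df; exact: is_deriveN. Qed.

Lemma is_derive_pt_sqr f z v (df : R) :
  is_derive z v f df ->
  is_derive z v (fun x => (f x : R) ^+ 2 : R^o) (f z * df + f z * df).
Proof. by move=> Df; exact: (is_derive_ptM Df Df). Qed.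

(** A directional derivative is an ordinary derivative along a line: this
    transports the one-variable chain rule to functions on V. *)
Lemma deriveE_line f z v :
  'D_1 (fun t : R => f (t *: v + z)) 0 = 'D_v f z.
Proof.
rewrite /derive; set g1 := fun h => h^-1 *: _; set g2 := fun h => h^-1 *: _.
suff -> : g1 = g2 by [].
by rewrite funeqE /g1 /g2 => h /=; rewrite addr0 scale0r add0r [_%:A]mulr1.
Qed.

(** Derivability of f in the single direction v suffices, because only the
    restriction of f to a line enters. *)
Lemma is_derive_pt_comp (h : R -> R) f z v (df : R) :
  derivable h (f z) 1 -> is_derive z v f df ->
  is_derive z v (fun x => h (f x) : R^o) ('D_1 h (f z) * df).
Proof.
move=> Dh [Df <-].
have E : (fun t : R => f (t *: v + z)) 0 = f z by rewrite scale0r add0r.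
have D1 : is_derive (0 : R) 1 (fun t : R => f (t *: v + z) : R) ('D_v f z).
  apply: DeriveDef; first exact: (derivable1P f z v).1 Df.
  exact: deriveE_line.
have D2 : is_derive (f z : R) 1 h ('D_1 h (f z)) by exact: derivableP.
rewrite -[X in is_derive X]E in D2.
have [D3 D3'] := is_derive1_comp D2 D1.
apply: DeriveDef; first exact: (derivable1P _ z v).2 D3.
by rewrite -[RHS]D3' -deriveE_line.
Qed.

End ScalarDerivatives.

Lemma is_derive_coord (R : realType) (n : nat) (i : 'I_n) (z v : 'rV[R]_n) :
  is_derive z v (fun w : 'rV[R]_n => w 0 i : R^o) (v 0 i).
Proof.
have D : derivable id z v by exact: derivable_id.
apply: DeriveDef; first exact: (derivable_mxP id z v).1.
by have := derive_mx D; rewrite derive_id => /rowP/(_ i); rewrite mxE => <-.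
Qed.

(** * Closure properties of smooth functions *)

Section SmoothFunctions.
Variables (R : realType) (V : normedModType R) (U : set V).
Hypothesis openU : open U.
Implicit Types f g : V -> R^o.

(** Differentiability is local: the differential of f is also a first-order
    expansion of g, whose increments agree with those of f near z. *)
Lemma differentiable_near f g z :
  (\near z, f z = g z) -> differentiable f z -> differentiable g z.
Proof.
move=> fg fd; have /diff_locallyP [dfc fE] := fd.
have gE : g \o shift z = cst (g z) + 'd f z +o_ 0 id.
  apply/eqaddoP => e e0.
  have /eqaddoP /(_ e e0) := fE.
  apply: filter_app.
  have : \forall y \near (0 : V), f (y + z) = g (y + z).
    by move: fg; rewrite (near_shift 0) subr0.
  apply: filter_app; near=> y; move=> /= yE.
  have fzgz : f z = g z by apply: nbhs_singleton fg.
  rewrite -[(_ + _) y]/(f (y + z) - (f z + 'd f z y)).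
  rewrite -[X in _ -> `|X| <= _]/(g (y + z) - (g z + 'd f z y)).
  by rewrite yE fzgz.
by apply/diff_locallyP; rewrite (diff_unique dfc gE).
Unshelve. all: by end_near. Qed.

(** The iterated derivatives of f and g must be compared on U only: the rules
    below, such as the one for the inverse, fail at the zeros of f, which lie
    outside U. *)
Lemma Cdiff_ext m f g : {in U, f =1 g} -> Cdiff m U f -> Cdiff m U g.
Proof.
elim: m f g => [|m IH] f g fg.
  move=> fc z Uz; have nfg : {near z, f =1 g}.
    by near=> w; apply: fg; rewrite inE; near: w; exact: open_nbhs_nbhs.
  have gf : g @ z --> f z by exact: cvg_trans (near_eq_cvg nfg) (fc z Uz).
  have E : f z = g z by apply: fg; rewrite inE.
  by rewrite E in gf.
have nfg z : U z -> {near z, f =1 g}.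
  by move=> Uz; near=> w; apply: fg; rewrite inE; near: w; exact: open_nbhs_nbhs.
move=> [fd fD]; split=> [z Uz|v].
  exact: differentiable_near (nfg z Uz) (fd z Uz).
apply: IH (fD v) => z; rewrite inE => Uz.
exact: near_eq_derive (nfg z Uz).
Unshelve. all: by end_near. Qed.

Lemma CdiffS m f : Cdiff m.+1 U f -> Cdiff m U f.
Proof.
elim: m f => [|m IH] f [fd fD]; last by split=> // v; apply: IH.
by move=> z Uz; apply: differentiable_continuous; exact: fd.
Qed.

Lemma Cdiff_cst m (r : R) : Cdiff m U (fun=> r : R^o).
Proof.
elim: m r => [|m IH] r; first by move=> z _; exact: cst_continuous.
split=> [z _|v]; first exact: differentiable_cst.
by apply: Cdiff_ext (IH 0) => z _; rewrite derive_cst.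
Qed.

Lemma CdiffD m f g : Cdiff m U f -> Cdiff m U g ->
  Cdiff m U (fun z => f z + g z : R^o).
Proof.
elim: m f g => [|m IH] f g; first by move=> fc gc z Uz; apply: continuousD; auto.
move=> [fd fD] [gd gD]; split=> [z Uz|v].
  by apply: differentiableD; auto.
apply: Cdiff_ext (IH _ _ (fD v) (gD v)) => z; rewrite inE => Uz.
by rewrite -deriveD //; apply: diff_derivable; auto.
Qed.

Lemma CdiffM m f g : Cdiff m U f -> Cdiff m U g ->
  Cdiff m U (fun z => f z * g z : R^o).
Proof.
elim: m f g => [|m IH] f g; first by move=> fc gc z Uz; apply: continuousM; auto.
move=> /[dup] /CdiffS f' [fd fD] /[dup] /CdiffS g' [gd gD]; split=> [z Uz|v].
  by apply: differentiableM; auto.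
apply: Cdiff_ext (CdiffD (IH _ _ f' (gD v)) (IH _ _ g' (fD v))) => z.
rewrite inE => Uz; symmetry; apply: deriveM; apply: diff_derivable; auto.
Qed.

Lemma CdiffV m f : (forall z, U z -> f z != 0) -> Cdiff m U f ->
  Cdiff m U (fun z => (f z)^-1 : R^o).
Proof.
move=> f0; elim: m => [|m IH]; first by move=> fc z Uz; apply: continuousV; auto.
move=> /[dup] /CdiffS f' [fd fD]; split=> [z Uz|v].
  by apply: differentiableV; auto.
have V' := IH f'.
apply: Cdiff_ext (CdiffM (CdiffM (Cdiff_cst m (-1)) (CdiffM V' V')) (fD v)) => z.
rewrite inE => Uz; rewrite deriveV ?f0//; last by apply: diff_derivable; auto.
by rewrite -[RHS]/(_ * _) mulN1r -invfM -expr2.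
Qed.

End SmoothFunctions.

Section SmoothClosure.
Variables (R : realType) (V : normedModType R) (U : set V).
Hypothesis openU : open U.
Implicit Types f g : V -> R^o.

Lemma smooth_cst (r : R) : smooth U (fun=> r : R^o).
Proof. by move=> m; exact: Cdiff_cst. Qed.

Lemma smoothD f g : smooth U f -> smooth U g ->
  smooth U (fun z => f z + g z : R^o).
Proof. by move=> fs gs m; exact: CdiffD. Qed.

Lemma smoothM f g : smooth U f -> smooth U g ->
  smooth U (fun z => f z * g z : R^o).
Proof. by move=> fs gs m; exact: CdiffM. Qed.

Lemma smoothV f : (forall z, U z -> f z != 0) -> smooth U f ->
  smooth U (fun z => (f z)^-1 : R^o).
Proof. by move=> f0 fs m; exact: CdiffV. Qed.

Lemma smoothN f : smooth U f -> smooth U (fun z => - f z : R^o).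
Proof.
move=> fs m; apply: Cdiff_ext (CdiffM openU (Cdiff_cst openU m (-1)) (fs m)) => //.
by move=> z _; rewrite mulN1r.
Qed.

End SmoothClosure.

Lemma smooth_coord (R : realType) (n : nat) (U : set 'rV[R]_n) (i : 'I_n) :
  open U -> smooth U (fun z : 'rV[R]_n => z 0 i : R^o).
Proof.
move=> oU; elim=> [|m _].
  by move=> z _; exact: coord_continuous.
split=> [z _|v]; first exact: differentiable_coord.
apply: Cdiff_ext (Cdiff_cst oU m (v 0 i)) => // z _.
by rewrite (@derive_val _ _ _ _ _ _ _ (is_derive_coord i z v)).
Qed.

Lemma smooth_derivable (R : realType) (h : R -> R) (t : R) :
  smooth [set: R^o] (h : R^o -> R^o) -> derivable h t 1.
Proof. by move=> /(_ 1%N)[Dh _]; exact: diff_derivable (Dh t I). Qed.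

(** * Sums over permutations and wedge products *)

(** Expansion of a sum over permutations according to the image of 0, the
    analogue of the Laplace expansion along the first row. *)
Lemma sum_perm_lift (T : nmodType) (n : nat) (F : 'S_n.+1 -> T) :
  \sum_s F s = \sum_(i < n.+1) \sum_(s : 'S_n) F (lift_perm ord0 i s).
Proof.
rewrite pair_big /= (reindex (fun p : 'I_n.+1 * 'S_n => lift_perm ord0 p.1 p.2)) //.
apply: onW_bij; apply: inj_card_bij; last first.
  by rewrite card_prod card_ord !card_Sn factS.
move=> [i s] [j t] /= /permP E.
have ij : i = j by have := E ord0; rewrite !lift_perm_id.
rewrite -ij in E *; congr (_, _); apply/permP => k.
by have := E (lift ord0 k); rewrite !lift_perm_lift => /lift_inj.
Qed.

Lemma sum_perm0 (T : nmodType) (F : 'S_0 -> T) : \sum_s F s = F 1%g.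
Proof.
rewrite (bigD1 1%g) //= big1 ?addr0 // => s /negP[]; apply/eqP/permP.
by case.
Qed.

Section Wedge.
Variables (R : realType) (n : nat).
Implicit Types z : 'rV[R]_n.

(** Reindexing the defining sum gives the antisymmetry, with no assumption on
    the two factors. *)
Lemma wedge_row_perm j l (u : Defs.form R n j) (w : Defs.form R n l) z
    (t : 'S_(j + l)) (v : 'M[R]_(j + l, n)) :
  wedge u w z (row_perm t v) = (-1) ^+ t * wedge u w z v.
Proof.
rewrite /wedge mulrCA; congr (_ * _).
rewrite [in RHS](reindex_inj (mulIg t)) mulr_sumr; apply: eq_bigr => s _ /=.
rewrite row_permM !mulrA; congr (_ * _ * _).
by rewrite odd_permM addbC signr_addb mulrA -signr_addb addbb mul1r.
Qed.

Lemma usubmx_row_perm l (v : 'M[R]_(1 + l, n)) (s : 'S_(1 + l)) :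
  usubmx (row_perm s v) = row (s 0) v.
Proof.
apply/matrixP => i k; rewrite !mxE (_ : lshift l i = 0) //.
by apply/val_inj; rewrite /= (ord1 i).
Qed.

Lemma wedge11 (u w : Defs.form R n 1) z (v : 'M[R]_(2, n)) :
  wedge u w z v = u z (row 0 v) * w z (row 1 v) - u z (row 1 v) * w z (row 0 v).
Proof.
rewrite /wedge !factS fact0 invr1 mul1r.
rewrite sum_perm_lift !big_ord_recl big_ord0 !sum_perm_lift !big_ord_recl !big_ord0.
rewrite !sum_perm0 !addr0 !odd_lift_perm odd_perm1 /= !expr1 !expr0 mul1r mulN1r.
have D (s : 'S_(1 + 1)) :
    dsubmx (row_perm s v : 'M[R]_(1 + 1, n)) = row (s (lift 0 0)) v.
  apply/matrixP => i k; rewrite !mxE; congr (v (s _) _).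
  by apply/val_inj; rewrite /= (ord1 i).
rewrite !usubmx_row_perm !D.
rewrite (_ : 0 = ord0) // !lift_perm_id !lift_perm_lift lift_perm_id mulNr.
by congr (_ * w z (row _ v) - u z (row _ v) * w z (row _ v)); apply/val_inj.
Qed.

(** Since u kills the rows of v, only the permutations that fix 0 contribute;
    by antisymmetry of w each of these l! permutations contributes the same
    amount, which cancels the normalization. *)
Lemma wedge_contract l (u : Defs.form R n 1) (w : Defs.form R n l) z
    (e : 'rV[R]_n) (v : 'M[R]_(l, n)) :
  (forall i, u z (row i v) = 0) ->
  (forall s : 'S_l, w z (row_perm s v) = (-1) ^+ s * w z v) ->
  wedge u w z (col_mx e v) = u z e * w z v.
Proof.
move=> uv wv; rewrite /wedge factS fact0 !mul1n.
under eq_bigr do rewrite usubmx_row_perm.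
rewrite sum_perm_lift big_ord_recl /= [X in _ * (_ + X)]big1; last first.
  move=> i _; apply: big1 => s _; rewrite lift_perm_id.
  rewrite (_ : row (lift ord0 i) (col_mx e v) = row i v); last first.
    have -> : lift ord0 i = rshift 1 i by exact/val_inj.
    exact: rowKd.
  by rewrite uv mulr0 mul0r.
rewrite addr0.
have wl (s : 'S_l) : (-1) ^+ lift_perm ord0 ord0 s *
    u z (row (lift_perm ord0 ord0 s 0) (col_mx e v)) *
    w z (dsubmx (@row_perm _ (1 + l) _ (lift_perm ord0 ord0 s) (col_mx e v))) =
    u z e * w z v :> R.
  rewrite lift_perm_id odd_lift_perm addFb.
  rewrite (_ : row 0 (col_mx e v) = e); last first.
    have -> : 0 = lshift l (0 : 'I_1) by exact/val_inj.
    rewrite -[RHS](row_id 0); exact: rowKu.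
  rewrite (_ : dsubmx _ = row_perm s v); last first.
    apply/matrixP => i k; rewrite mxE mxE [in RHS]mxE.
    rewrite (_ : rshift 1 i = lift ord0 i); last exact/val_inj.
    rewrite lift_perm_lift.
    have -> : lift ord0 (s i) = rshift 1 (s i) by exact/val_inj.
    exact: col_mxEd.
  by rewrite wv mulrACA -signr_addb addbb mul1r.
rewrite (eq_bigr _ (fun s _ => wl s)) sumr_const card_Sn -[X in _^-1 * X]mulr_natl.
by rewrite mulKf // pnatr_eq0 -lt0n fact_gt0.
Qed.

End Wedge.

(** Each of the three perfect matchings of four points is counted 8 times: the
    two pairs can be exchanged, and so can the members of each pair. *)
Lemma sum_perm4_pfaffian (R : comNzRingType) (f : 'I_4 -> 'I_4 -> R) :
  (forall i j, f i j = - f j i) ->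
  \sum_(s : 'S_4) (-1) ^+ s * (f (s 0) (s 1) * f (s 2) (s 3)) =
  8 * (f 0 1 * f 2 3 - f 0 2 * f 1 3 + f 0 3 * f 1 2).
Proof.
(* on natural indices, the images of the lifted permutations compute *)
move=> fN; pose g i j : R := f (inord i) (inord j).
have fE i j : f i j = g i j by rewrite /g !inord_val.
have gN i j : g i j = - g j i by exact: fN.
have o1 : 1 = lift ord0 ord0 :> 'I_4 by exact/val_inj.
have o2 : 2 = lift ord0 (lift ord0 ord0) :> 'I_4 by exact/val_inj.
have o3 : 3 = lift ord0 (lift ord0 (lift ord0 ord0)) :> 'I_4 by exact/val_inj.
under eq_bigr => s _ do rewrite !fE o3 o2 o1.
do 4 rewrite !sum_perm_lift !big_ord_recl !big_ord0.
rewrite !sum_perm0 !odd_lift_perm !odd_perm1.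
rewrite !(lift_perm_id, lift_perm_lift) !fE /=.
rewrite /bump /=.
rewrite (gN 1 0)%N (gN 2 0)%N (gN 3 0)%N (gN 2 1)%N (gN 3 1)%N (gN 3 2)%N.
ring.
Qed.

(** The constant 1 as a 0-form is a unit for the wedge product; it is where the
    recursion that defines wedge powers starts. *)
Lemma wedge_one (R : realType) (n : nat) (w : Defs.form R n 2)
    (z : 'rV[R]_n) (v : 'M[R]_(2, n)) :
  (forall s : 'S_2, w z (row_perm s v) = (-1) ^+ s * w z v) ->
  wedge w (fun _ (_ : 'M[R]_(0, n)) => 1) z v = w z v.
Proof.
move=> wN; rewrite /wedge.
under eq_bigr => s _.
  rewrite mulr1 (_ : usubmx _ = row_perm s v); last first.
    by apply/matrixP => i k; rewrite !mxE; congr (v (s _) k); apply/val_inj.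
  rewrite wN mulrA -signr_addb addbb mul1r; over.
by rewrite sumr_const card_Sn fact0 muln1 -[X in _^-1 * X]mulr_natl mulKf.
Qed.

(** The exterior square of a 2-form is twice the Pfaffian: the 8 in
    sum_perm4_pfaffian is divided by the normalization 2! 2!. *)
Lemma wedge_pow2 (R : realType) (n : nat) (w : Defs.form R n 2)
    (z : 'rV[R]_n) (v : 'M[R]_(4, n)) :
  (forall (s : 'S_2) u, w z (row_perm s u) = (-1) ^+ s * w z u) ->
  let W i j := w z (\matrix_(l < 2) row (if l == 0 then i else j) v) in
  wedge_pow w 2 z v = 2 * (W 0 1 * W 2 3 - W 0 2 * W 1 3 + W 0 3 * W 1 2).
Proof.
move=> wN W; have WN i j : W i j = - W j i.
  have <- : (-1) ^+ tperm (0 : 'I_2) 1 * W j i = - W j i.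
    by rewrite odd_tperm mulN1r.
  rewrite /W -wN.
  congr (w z _); apply/matrixP => a c; rewrite !mxE; congr (v _ _).
  case: a => [[|[|//]] h].
    by rewrite (_ : Ordinal h = 0) ?tpermL //; exact/val_inj.
  by rewrite (_ : Ordinal h = 1) ?tpermR //; exact/val_inj.
rewrite -[LHS]/(wedge w (wedge w (fun _ (_ : 'M[R]_(0, n)) => 1)) z v) /wedge.
have := sum_perm4_pfaffian WN.
set S := (X in X = _) => ES.
set T := (X in _ * X = _); have -> : T = S; last first.
  by rewrite ES (_ : _%:R^-1 = 4^-1 :> R) //; field.
apply: eq_bigr => s _; rewrite -mulrA; congr (_ * (_ * _)).
  congr (w z _); apply/matrixP => a c; rewrite !mxE; congr (v _ _).
  by case: a => [[|[|//]] h] /=; congr (s _); exact/val_inj.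
rewrite -[LHS]/(wedge w (fun _ (_ : 'M[R]_(0, n)) => 1) z _) wedge_one //.
congr (w z _); apply/matrixP => a c; rewrite !mxE; congr (v _ _).
by case: a => [[|[|//]] h] /=; congr (s _); exact/val_inj.
Qed.

Lemma dfun_derive (R : realType) (n : nat) (f : 'rV[R]_n -> R) z
    (v : 'M[R]_(1, n)) (df : R) :
  is_derive z v (f : 'rV[R]_n -> R^o) df -> dfun f z v = df.
Proof.
move=> [_ <-]; rewrite /dfun /ext_d big_ord_recl big_ord0 addr0 expr0 mul1r.
by rewrite row_id.
Qed.

(** * The almost cosymplectic structure of the Siegel-Jacobi half-plane *)

Section Forms.
Variables (R : realType) (delta k nu : R).
Hypotheses (hdelta : 0 < delta) (hk : k != 0) (hnu : nu != 0).
Notation V := 'rV[R]_(2 + 2 + 1).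
Implicit Types z : V.

Lemma dfun_coordE (i : 'I_(2 + 2 + 1)) z (v : V) :
  dfun (fun w : V => w 0 i) z v = v 0 i.
Proof. exact: dfun_derive (is_derive_coord i z v). Qed.

Lemma thetaJE z (v : 'M[R]_(1, 2 + 2 + 1)) : thetaJ delta z v =
  Num.sqrt delta * (v 0 ik - pc z * v 0 iq + qc z * v 0 ip).
Proof. by rewrite /thetaJ !dfun_coordE. Qed.

Lemma omegaJE z (v : 'M[R]_(2, 2 + 2 + 1)) : omegaJ k nu z v =
  k / yc z ^+ 2 * (v 0 ix * v 1 iy - v 1 ix * v 0 iy) +
  2 * nu * (v 0 iq * v 1 ip - v 1 iq * v 0 ip).
Proof. by rewrite /omegaJ !wedge11 !dfun_coordE !mxE. Qed.

Lemma open_XJ1 : open (@XJ1 R).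
Proof.
have -> : @XJ1 R = (fun z => z 0 iy) @^-1` [set t | 0 < t] by [].
apply: open_comp; last exact: open_gt.
by move=> z _; exact: coord_continuous.
Qed.

Lemma diff_form_thetaJ : diff_form (@XJ1 R) (thetaJ delta).
Proof.
split=> [z _|v].
  split=> [i A B C b c /rowP rA _ _|A i1 i2].
    have E l : A 0 l = b * B 0 l + c * C 0 l.
      by have := rA l; rewrite (ord1 i) !mxE.
    by rewrite !thetaJE !E; ring.
  by rewrite (ord1 i1) (ord1 i2) eqxx.
under [X in smooth _ X]funext => z do rewrite thetaJE.
have oX := open_XJ1.
have sq : smooth (@XJ1 R) (@qc R) by exact: smooth_coord.
have sp : smooth (@XJ1 R) (@pc R) by exact: smooth_coord.
repeat first [exact: smooth_cst | exact: sq | exact: sp | apply: smoothM => //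
  | apply: smoothD => // | apply: smoothN => //].
Qed.

Lemma diff_form_omegaJ : diff_form (@XJ1 R) (omegaJ k nu).
Proof.
split=> [z _|v].
  split=> [i A B C b c /rowP rA rB rC|A i1 i2 ne /rowP rA].
    have E l : A i l = b * B i l + c * C i l by have := rA l; rewrite !mxE.
    have F j l : i != j -> A j l = B j l /\ A j l = C j l.
      case: (unliftP i j) => [j' -> _|->]; last by rewrite eqxx.
      have /rowP/(_ l) := congr1 (row j') rB; have /rowP/(_ l) := congr1 (row j') rC.
      by rewrite !mxE => -> ->.
    rewrite !omegaJE; move: i E F {rA rB rC} => [[|[|//]] lti] E F.
      have -> : (0 : 'I_2) = Ordinal lti by exact/val_inj.
      rewrite !E; have G l := F 1 l isT.
      rewrite -!(G _).1 -!(G _).2; ring.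
    have -> : (1 : 'I_2) = Ordinal lti by exact/val_inj.
    rewrite !E; have G l := F 0 l isT.
    rewrite -!(G _).1 -!(G _).2; ring.
  have E l : A 0 l = A 1 l.
    have := rA l; rewrite !mxE.
    case: i1 i2 ne {rA} => [[|[|//]] h1] [[|[|//]] h2] //= _ H.
      by rewrite (_ : 0 = Ordinal h1) 1?(_ : 1 = Ordinal h2) //; exact/val_inj.
    by rewrite (_ : 0 = Ordinal h2) 1?(_ : 1 = Ordinal h1) //; exact/val_inj.
  by rewrite omegaJE !E; ring.
under [X in smooth _ X]funext => z do rewrite omegaJE.
have oX := open_XJ1.
have sy : smooth (@XJ1 R) (fun z => (yc z ^+ 2)^-1).
  apply: smoothV => // [z yz|]; first by rewrite expf_neq0 // gt_eqF.
  under [X in smooth _ X]funext => z do rewrite expr2.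
  by apply: smoothM => //; exact: smooth_coord.
apply: smoothD => //; last exact: smooth_cst.
apply: smoothM => //; last exact: smooth_cst.
by apply: smoothM => //; exact: smooth_cst.
Qed.

Lemma omegaJ_row_perm z (s : 'S_2) v :
  omegaJ k nu z (row_perm s v) = (-1) ^+ s * omegaJ k nu z v.
Proof.
have W (u w : Defs.form R (2 + 2 + 1) 1) :
  wedge u w z (row_perm s v) = (-1) ^+ s * wedge u w z v :=
  @wedge_row_perm R _ 1 1 u w z s v.
rewrite /omegaJ !W.
by rewrite mulrDr; congr (_ + _); exact: mulrCA.
Qed.

Lemma form_rank_omegaJ z : 0 < yc z -> form_rank (omegaJ k nu) z = 4.
Proof.
move=> yz; rewrite /form_rank.
pose J (r : R) : 'M[R]_2 := \matrix_(i, j) (r * ((i < j)%N%:R - (j < i)%N%:R)).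
have rJ r : r != 0 -> \rank (J r) = 2.
  move=> r0; have : J r *m J (- r^-1) = 1%:M.
    apply/matrixP => i j; rewrite !mxE !big_ord_recl big_ord0 !mxE.
    by case: i j => [[|[|//]] ?] [[|[|//]] ?] /=; rewrite /bump /=; field.
  by case/mulmx1_unit => uJ _; exact: mxrank_unit.
rewrite (_ : \matrix_(_, _) _ = block_mx
  (block_mx (J (k / yc z ^+ 2)) 0 0 (J (2 * nu))) 0 0 (0 : 'M[R]_1)); last first.
  apply/matrixP => i j; rewrite mxE omegaJE !mxE -!val_eqE /=.
  case: splitP => i' ->; rewrite mxE; case: splitP => j' ->; rewrite ?mxE /=.
  - case: splitP => i2 ->; rewrite mxE; case: splitP => j2 ->; rewrite !mxE.
    + by case: i2 j2 => [[|[|//]] ?] [[|[|//]] ?] /=; ring.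
    + by case: i2 j2 => [[|[|//]] ?] [[|[|//]] ?] /=; ring.
    + by case: i2 j2 => [[|[|//]] ?] [[|[|//]] ?] /=; ring.
    + by case: i2 j2 => [[|[|//]] ?] [[|[|//]] ?] /=; ring.
  - by ring.
  - by ring.
  - by ring.
rewrite !rank_diag_block_mx !rJ ?mxrank0 //.
  by rewrite mulf_neq0 // pnatr_eq0.
by rewrite mulf_neq0 // invr_neq0 // expf_neq0 // gt_eqF.
Qed.

(** After differentiation every term carries the y-components of two of the
    three vectors, and the alternating sum cancels: this is dy /\ dx /\ dy = 0. *)
Lemma ext_d_omegaJ z v : XJ1 z -> ext_d (omegaJ k nu) z v = 0.
Proof.
move=> yz; have y0 : yc z != 0 by rewrite gt_eqF.
have D (u : V) (w : 'M[R]_(2, 2 + 2 + 1)) :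
    'D_u (fun z' => omegaJ k nu z' w : R^o) z =
    - 2 * k / yc z ^+ 3 * u 0 iy * (w 0 ix * w 1 iy - w 1 ix * w 0 iy).
  under [X in 'D_u X z]funext => z' do rewrite omegaJE.
  have Dy : is_derive z u (@yc R : V -> R^o) (u 0 iy) by exact: is_derive_coord.
  have Dy2 := is_derive_ptM Dy Dy.
  have Dv := @is_derive_ptV _ _ (fun w => yc w * yc w : R^o) z u _
    (mulf_neq0 y0 y0) Dy2.
  have Dk := is_derive_ptM (is_derive_ptC k z u) Dv.
  have Dw := is_derive_ptM Dk (is_derive_ptC (w 0 ix * w 1 iy - w 1 ix * w 0 iy) z u).
  have [_ E] := is_derive_ptD Dw
    (is_derive_ptC (2 * nu * (w 0 iq * w 1 ip - w 1 iq * w 0 ip)) z u).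
  rewrite [LHS]E; field.
  by rewrite y0.
rewrite /ext_d; under eq_bigr => i _ do rewrite D.
rewrite !big_ord_recl big_ord0 !mxE /=.
(* on natural indices, the rows selected by lift compute *)
pose w i c := v (inord i) c.
have vE (i : 'I_3) c : v i c = w i c by rewrite /w inord_val.
by rewrite !vE /= /bump /=; ring.
Qed.

Lemma volume_neq0 z : 0 < yc z ->
  exists v, wedge (thetaJ delta) (wedge_pow (omegaJ k nu) 2) z v != 0.
Proof.
(* the rows of F are d/dx, d/dy, d/dq + p d/dkappa and d/dp - q d/dkappa, all in
   the kernel of theta *)
move=> yz; pose F : 'M[R]_(2.*2, 2 + 2 + 1) := \matrix_(i, j)
  ((i == j :> nat)%:R + (j == 4 :> nat)%:R *
     ((i == 2 :> nat)%:R * pc z - (i == 3 :> nat)%:R * qc z)).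
exists (col_mx (delta_mx 0 ik) F).
rewrite wedge_contract; first last.
- by move=> s; apply: wedge_row_perm.
- move=> i; rewrite thetaJE !mxE /=.
  by case: i => [[|[|[|[|//]]]] ?] /=; ring.
rewrite (@wedge_pow2 _ _ _ _ F); last by move=> s u; exact: omegaJ_row_perm.
rewrite thetaJE !omegaJE !mxE /=.
rewrite [X in X != 0](_ : _ =
  Num.sqrt delta * (2 * (k / yc z ^+ 2 * (2 * nu)))); last by ring.
have y0 : yc z != 0 by rewrite gt_eqF.
have sd0 : Num.sqrt delta != 0 by rewrite gt_eqF // sqrtr_gt0.
by rewrite !mulf_neq0 ?invr_neq0 ?expf_neq0 ?pnatr_eq0.
Qed.

Lemma gtacos_J : gtacos (N := 2) (@XJ1 R) (thetaJ delta) (omegaJ k nu).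
Proof.
split; last by move=> z v; exact: ext_d_omegaJ.
split.
- exact: open_XJ1.
- exact: diff_form_thetaJ.
- exact: diff_form_omegaJ.
- by move=> z; exact: form_rank_omegaJ.
- by move=> z; exact: volume_neq0.
Qed.

End Forms.

(** * The chart (Q, P, kappa) *)

Section Chart.
Variables (R : realType) (delta k nu : R).
Hypotheses (hdelta : 0 < delta) (hk : k != 0) (hnu : nu != 0).
Notation V := 'rV[R]_(2 + 2 + 1).
Implicit Types z w : V.

Let nu2 : 2 * nu != 0. Proof. by rewrite mulf_neq0 ?pnatr_eq0. Qed.

Lemma phiJK z : psiJ k nu (phiJ k nu z) = z.
Proof.
apply/rowP => i; rewrite !mxE /=.
case: i => [[|[|[|[|[|//]]]]] h] /=; rewrite ?opprK ?invrK ?invrN ?opprK ?invrK.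
- by rewrite mulrC mulKf //; congr (z _ _); exact/val_inj.
- by congr (z _ _); exact/val_inj.
- by rewrite mulrC mulKf //; congr (z _ _); exact/val_inj.
- by congr (z _ _); exact/val_inj.
- by congr (z _ _); exact/val_inj.
Qed.

(** At P_1 = 0, outside the image of the half-plane, this relies on the inverse
    of 0 being 0. *)
Lemma psiJK w : phiJ k nu (psiJ k nu w) = w.
Proof.
apply/rowP => i; rewrite !mxE /xc /yc /qc /pc /kc !mxE /=.
case: i => [[|[|[|[|[|//]]]]] h] /=; rewrite ?opprK ?invrK ?invrN ?opprK ?invrK.
- by rewrite mulrC divfK //; congr (w _ _); exact/val_inj.
- by rewrite mulrC divfK //; congr (w _ _); exact/val_inj.
- by congr (w _ _); exact/val_inj.
- by congr (w _ _); exact/val_inj.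
- by congr (w _ _); exact/val_inj.
Qed.

Lemma image_phiJ : phiJ k nu @` @XJ1 R = [set w | w 0 (iP 0) < 0].
Proof.
apply/seteqP; split=> [_ [z yz <-]|w /= wP].
  by rewrite /= mxE /= oppr_lt0 invr_gt0.
exists (psiJ k nu w); last exact: psiJK.
by rewrite /XJ1 /= /yc mxE /= oppr_gt0 invr_lt0.
Qed.

Lemma coordinates_J : coordinates (@XJ1 R) (phiJ k nu) (psiJ k nu).
Proof.
have oX := @open_XJ1 R.
have oI : open (phiJ k nu @` @XJ1 R).
  rewrite image_phiJ.
  apply: (@open_comp _ _ (fun w : V => w 0 (iP 0)) [set t | t < 0]).
    by move=> z _; exact: coord_continuous.
  exact: open_lt.
split=> // [z _|i|i]; first exact: phiJK.
- under [X in smooth _ X]funext => z do rewrite mxE.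
  have sc j : smooth (@XJ1 R) (fun z => z 0 j : R^o) by exact: smooth_coord.
  case: i => [[|[|[|[|[|//]]]]] h] /=.
  + by apply: smoothM => //; [exact: smooth_cst|exact: sc].
  + by apply: smoothM => //; [exact: smooth_cst|exact: sc].
  + apply: smoothN => //; apply: smoothV => //; last exact: sc.
    by move=> z yz; rewrite gt_eqF.
  + exact: sc.
  + exact: sc.
- under [X in smooth _ X]funext => z do rewrite mxE.
  have sc j : smooth (phiJ k nu @` @XJ1 R) (fun z => z 0 j : R^o).
    exact: smooth_coord.
  case: i => [[|[|[|[|[|//]]]]] h] /=.
  + by apply: smoothM => //; exact: smooth_cst.
  + apply: smoothN => //; apply: smoothV => //.
    by move=> z; rewrite image_phiJ /= => wP; rewrite lt_eqF.
  + by apply: smoothM => //; exact: smooth_cst.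
  + exact: sc.
  + exact: sc.
Qed.

Lemma coord_phiQ0 : Defs.coord (phiJ k nu) (iQ 0) = fun z => k * xc z.
Proof. by apply/funext => z; rewrite /Defs.coord mxE. Qed.
Lemma coord_phiQ1 : Defs.coord (phiJ k nu) (iQ 1) = fun z => 2 * nu * qc z.
Proof. by apply/funext => z; rewrite /Defs.coord mxE. Qed.
Lemma coord_phiP0 : Defs.coord (phiJ k nu) (iP 0) = fun z => - (yc z)^-1.
Proof. by apply/funext => z; rewrite /Defs.coord mxE. Qed.
Lemma coord_phiP1 : Defs.coord (phiJ k nu) (iP 1) = @pc R.
Proof. by apply/funext => z; rewrite /Defs.coord mxE. Qed.
Lemma coord_phiK : Defs.coord (phiJ k nu) (iK 2) = @kc R.
Proof. by apply/funext => z; rewrite /Defs.coord mxE. Qed.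
Definition coord_phiJ :=
  (coord_phiQ0, coord_phiQ1, coord_phiP0, coord_phiP1, coord_phiK).

Lemma dfun_scale (r : R) i z (v : V) :
  dfun (fun z : V => r * z 0 i) z v = r * v 0 i.
Proof.
have D := is_derive_ptM (is_derive_ptC r z v) (is_derive_coord i z v).
by rewrite (dfun_derive D) mulr0 addr0.
Qed.

Lemma dfun_Ninv_yc z (v : V) : yc z != 0 ->
  dfun (fun z : V => - (yc z)^-1) z v = (yc z ^+ 2)^-1 * v 0 iy.
Proof.
move=> y0; have D := is_derive_ptV y0 (is_derive_coord iy z v).
have [_ E] := is_deriveN D.
rewrite /dfun /ext_d big_ord_recl big_ord0 addr0 expr0 mul1r row_id.
by rewrite [LHS]E mulNr opprK.
Qed.

Lemma adapted_J : adapted (N := 2) (@XJ1 R) (thetaJ delta) (omegaJ k nu)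
  (phiJ k nu) (caJ delta nu) (cbJ delta) (c0J delta).
Proof.
move=> z yz; have y0 : yc z != 0 by rewrite gt_eqF.
have o1 : lift ord0 ord0 = 1 :> 'I_2 by exact/val_inj.
split=> [|v|v].
- by rewrite /c0J gt_eqF // sqrtr_gt0.
- rewrite omegaJE !big_ord_recl big_ord0 o1 !coord_phiJ !wedge11.
  rewrite !dfun_scale !dfun_Ninv_yc // !dfun_coordE !mxE; field.
  by rewrite y0.
- rewrite thetaJE !big_ord_recl big_ord0 o1 !coord_phiJ.
  rewrite !dfun_scale !dfun_Ninv_yc // !dfun_coordE /caJ /cbJ /c0J /=; field.
  by rewrite ?hnu ?pnatr_eq0.
Qed.

End Chart.

(** * Partial derivatives of the energy *)

Section Energy.
Variables (R : realType) (k nu a b c m n : R) (h : R -> R).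
Notation V := 'rV[R]_(2 + 2 + 1).
Hypothesis hh : forall t, derivable h t 1.
Local Notation H := (energy k nu a b c m n h).

Definition energy_x : V -> R := fun z =>
  k / yc z * (2 * (m + c) * xc z - 2 * n).
Definition energy_y : V -> R := fun z =>
  k / yc z ^+ 2 * ((m + c) * (yc z ^+ 2 - xc z ^+ 2) + 2 * n * xc z + m - c).
Definition energy_q : V -> R := fun z =>
  2 * nu * ((m + c) * qc z + n * pc z + a).
Definition energy_p : V -> R := fun z =>
  2 * nu * ((c - m) * pc z + n * qc z + b).
Definition energy_k : V -> R := fun z => 'D_1 h (kc z).

(** The map X is left arbitrary so that the same computation yields the partial
    derivatives in the coordinates of the half-plane (X the identity) and in the
    chart (X the inverse of the chart). *)
Lemma derive_energy (W : normedModType R) (X : W -> V) (w v : W)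
    (dx dy dq dp dk : R) :
  yc (X w) != 0 ->
  is_derive w v (fun w => xc (X w) : R^o) dx ->
  is_derive w v (fun w => yc (X w) : R^o) dy ->
  is_derive w v (fun w => qc (X w) : R^o) dq ->
  is_derive w v (fun w => pc (X w) : R^o) dp ->
  is_derive w v (fun w => kc (X w) : R^o) dk ->
  is_derive w v (fun w => H (X w) : R^o)
    (energy_x (X w) * dx + energy_y (X w) * dy + energy_q (X w) * dq +
     energy_p (X w) * dp + energy_k (X w) * dk).
Proof.
move=> y0 Dx Dy Dq Dp Dk; rewrite /energy /Hqp /Hxy.
apply: is_derive_eq.
  have Dh := @is_derive_pt_comp _ _ h (fun w => kc (X w) : R^o) w v dk
    (@hh _) Dk.
  have Dv := @is_derive_ptV _ _ (fun w => yc (X w) : R^o) w v dy y0 Dy.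
  repeat first [exact: Dh | exact: Dx | exact: Dv | exact: Dy | exact: Dq
    | exact: Dp | exact: is_derive_ptC | apply: is_derive_ptD | apply: is_derive_ptN
    | apply: is_derive_pt_sqr | apply: is_derive_ptM].
(* some of these values are scalings of R by itself, opaque to field *)
rewrite /energy_x /energy_y /energy_q /energy_p /energy_k /GRing.scale /=; field.
by rewrite y0.
Qed.

Lemma pd_energy (i : 'I_(2 + 2 + 1)) z : yc z != 0 -> pd i H z =
  energy_x z * (ix == i)%:R + energy_y z * (iy == i)%:R +
  energy_q z * (iq == i)%:R + energy_p z * (ip == i)%:R +
  energy_k z * (ik == i)%:R.
Proof.
move=> y0.
have C j : is_derive z (delta_mx 0 i) (fun w : V => w 0 j : R^o) (j == i)%:R.
  by have := is_derive_coord j z (delta_mx 0 i); rewrite mxE eqxx.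
have [_ E] := @derive_energy _ id z _ _ _ _ _ _ y0 (C ix) (C iy) (C iq) (C ip) (C ik).
exact: E.
Qed.

Hypotheses (hk : k != 0) (hnu : nu != 0).

Lemma chart_pd_energy (i : 'I_(2 + 2 + 1)) z : yc z != 0 ->
  chart_pd (phiJ k nu) (psiJ k nu) i H z =
  energy_x z * ((iQ 0 == i)%:R / k) + energy_y z * (yc z ^+ 2 * (iP 0 == i)%:R) +
  energy_q z * ((iQ 1 == i)%:R / (2 * nu)) + energy_p z * (iP 1 == i)%:R +
  energy_k z * (iK 2 == i)%:R.
Proof.
move=> y0; rewrite /chart_pd /pd.
set w := phiJ k nu z; have zE : psiJ k nu w = z by exact: phiJK.
have C j : is_derive w (delta_mx 0 i) (fun w : V => w 0 j : R^o) (j == i)%:R.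
  by have := is_derive_coord j w (delta_mx 0 i); rewrite mxE eqxx.
have wP : w 0 (iP 0) = - (yc z)^-1 by rewrite mxE.
have P0 : w 0 (iP 0) != 0 by rewrite wP oppr_eq0 invr_eq0.
have y1 : yc (psiJ k nu w) != 0 by rewrite zE.
have Dx : is_derive w (delta_mx 0 i) (fun w => xc (psiJ k nu w) : R^o)
    ((iQ 0 == i)%:R / k).
  have -> : (fun w => xc (psiJ k nu w)) = fun w => w 0 (iQ 0) / k.
    by apply/funext => u; rewrite /xc mxE.
  have D := is_derive_ptM (f := fun u : V => u 0 (iQ 0)) (C _) (is_derive_ptC k^-1 w _).
  apply: (is_derive_eq D).
  by ring.
have Dy : is_derive w (delta_mx 0 i) (fun w => yc (psiJ k nu w) : R^o)
    (yc z ^+ 2 * (iP 0 == i)%:R).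
  have -> : (fun w => yc (psiJ k nu w)) = fun w => - (w 0 (iP 0))^-1.
    by apply/funext => u; rewrite /yc mxE.
  have D := is_derive_ptN (is_derive_ptV (f := fun u : V => u 0 (iP 0)) P0 (C _)).
  apply: (is_derive_eq D).
  by rewrite wP; field.
have Dq : is_derive w (delta_mx 0 i) (fun w => qc (psiJ k nu w) : R^o)
    ((iQ 1 == i)%:R / (2 * nu)).
  have -> : (fun w => qc (psiJ k nu w)) = fun w => w 0 (iQ 1) / (2 * nu).
    by apply/funext => u; rewrite /qc mxE.
  have D := is_derive_ptM (f := fun u : V => u 0 (iQ 1)) (C _)
    (is_derive_ptC (2 * nu)^-1 w _).
  apply: (is_derive_eq D).
  by ring.
have Dp : is_derive w (delta_mx 0 i) (fun w => pc (psiJ k nu w) : R^o)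
    (iP 1 == i)%:R.
  have -> : (fun w => pc (psiJ k nu w)) = fun w => w 0 (iP 1); last exact: C.
  by apply/funext => u; rewrite /pc mxE.
have Dk : is_derive w (delta_mx 0 i) (fun w => kc (psiJ k nu w) : R^o)
    (iK 2 == i)%:R.
  have -> : (fun w => kc (psiJ k nu w)) = fun w => w 0 (iK 2); last exact: C.
  by apply/funext => u; rewrite /kc mxE.
have [_ E] := derive_energy y1 Dx Dy Dq Dp Dk.
by rewrite zE in E; exact: E.
Qed.

End Energy.

(** * Equations of motion along curves *)

Section Motion.
Variables (R : realType) (dim : nat) (J : set R) (g : R -> 'rV[R]_dim).
Implicit Types f F : 'rV[R]_dim -> R.

Lemma dot_scale (r : R) f F : r != 0 ->
  dot J g (fun z => r * f z) F <-> dot J g f (fun z => F z / r).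
Proof.
move=> r0; split=> D t Jt.
  have D' := is_derive_ptM (is_derive_ptC r^-1 (t : R^o) 1) (D t Jt).
  rewrite (_ : f \o g = fun s => r^-1 * ((fun z => r * f z) \o g) s); last first.
    by apply/funext => s /=; rewrite mulKf.
  by apply: (is_derive_eq D'); ring.
have D' := is_derive_ptM (is_derive_ptC r (t : R^o) 1) (D t Jt).
by apply: (is_derive_eq D'); field.
Qed.

(** The function f is recovered from - 1 / f by the same operation, which gives
    the converse direction without assuming f derivable along the curve. *)
Lemma dot_Ninv f F : (forall t, J t -> f (g t) != 0) ->
  dot J g (fun z => - (f z)^-1) F <-> dot J g f (fun z => f z ^+ 2 * F z).
Proof.
move=> f0; split=> D t Jt; have f0t := f0 t Jt.
  have n0 : ((fun z => - (f z)^-1) \o g) t != 0 by rewrite oppr_eq0 invr_eq0.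
  have D' := is_derive_ptN (is_derive_ptV n0 (D t Jt)).
  rewrite (_ : f \o g = fun s => - (((fun z => - (f z)^-1) \o g) s)^-1); last first.
    by apply/funext => s /=; rewrite invrN invrK opprK.
  by apply: (is_derive_eq D') => /=; field.
have D' := is_derive_ptN (is_derive_ptV f0t (D t Jt)).
by apply: (is_derive_eq D') => /=; field.
Qed.

Lemma eq_dot5 f1 f2 f3 f4 f5 F1 F2 F3 F4 F5 F1' F2' F3' F4' F5' :
  (forall t, J t -> [/\ F1 (g t) = F1' (g t), F2 (g t) = F2' (g t),
     F3 (g t) = F3' (g t), F4 (g t) = F4' (g t) & F5 (g t) = F5' (g t)]) ->
  [/\ dot J g f1 F1, dot J g f2 F2, dot J g f3 F3, dot J g f4 F4
    & dot J g f5 F5] <->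
  [/\ dot J g f1 F1', dot J g f2 F2', dot J g f3 F3', dot J g f4 F4'
    & dot J g f5 F5'].
Proof.
move=> E; split=> -[D1 D2 D3 D4 D5]; split=> t Jt;
  have [E1 E2 E3 E4 E5] := E t Jt.
- by rewrite -E1; exact: D1.
- by rewrite -E2; exact: D2.
- by rewrite -E3; exact: D3.
- by rewrite -E4; exact: D4.
- by rewrite -E5; exact: D5.
- by rewrite E1; exact: D1.
- by rewrite E2; exact: D2.
- by rewrite E3; exact: D3.
- by rewrite E4; exact: D4.
- by rewrite E5; exact: D5.
Qed.

End Motion.

Lemma forall_I2 (P : 'I_2 -> Prop) : (forall i, P i) <-> P 0 /\ P 1.
Proof.
split=> [//|[P0 P1] [[|[|//]] h]].
  by rewrite (_ : Ordinal h = 0) //; exact/val_inj.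
by rewrite (_ : Ordinal h = 1) //; exact/val_inj.
Qed.

Theorem proposition2 (R : realType) (delta k nu a b c m n : R) (h : R -> R)
    (hdelta : 0 < delta) (hk : k != 0) (hnu : nu != 0)
    (hh : smooth [set: R^o] (h : R^o -> R^o)) :
  let H := energy k nu a b c m n h in
  let phi := phiJ k nu in
  let psi := psiJ k nu in
  let ca := caJ delta nu in
  let cb := cbJ delta in
  let c0 := c0J delta in
  let A := eomQ phi psi cb c0 H in
  let B := eomP phi psi ca c0 H in
  let C := eomK phi psi ca cb c0 H in
  [/\ gtacos (N := 2) (@XJ1 R) (thetaJ delta) (omegaJ k nu),
      coordinates (@XJ1 R) phi psi /\
        adapted (N := 2) (@XJ1 R) (thetaJ delta) (omegaJ k nu) phi ca cb c0,
      (forall z, XJ1 z ->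
        [/\ A 0 z = yc z ^+ 2 * pd iy H z,
            A 1 z = pd ip H z - qc z * pd ik H z,
            B 0 z = - k^-1 * pd ix H z,
            B 1 z = - (2 * nu)^-1 * (pd iq H z + pc z * pd ik H z) &
            C z = (2 * nu)^-1 * (pc z * pd ip H z + qc z * pd iq H z) - H z]) &
      (forall (J : set R) (g : R -> 'rV[R]_(2 + 2 + 1)),
        open (J : set R^o) -> (forall t, J t -> XJ1 (g t)) ->
        (motion phi psi ca cb c0 H J g <->
         [/\ dot J g (@xc R) (fun z => yc z ^+ 2 / k * pd iy H z),
             dot J g (@yc R) (fun z => - (yc z ^+ 2 / k) * pd ix H z),
             dot J g (@qc R) (fun z =>
               (2 * nu)^-1 * (pd ip H z - qc z * pd ik H z)),
             dot J g (@pc R) (fun z =>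
               - (2 * nu)^-1 * (pd iq H z + pc z * pd ik H z)) &
             dot J g (@kc R) (fun z =>
               (2 * nu)^-1 * (pc z * pd ip H z + qc z * pd iq H z) - H z)]) /\
        (motion phi psi ca cb c0 H J g <->
         [/\ dot J g (@xc R) (fun z =>
               (m + c) * (yc z ^+ 2 - xc z ^+ 2) + 2 * n * xc z + m - c),
             dot J g (@yc R) (fun z =>
               - 2 * yc z * ((m + c) * xc z - n)),
             dot J g (@qc R) (fun z =>
               (c - m) * pc z + n * qc z + b
               - qc z / (2 * nu) * pd ik H z),
             dot J g (@pc R) (fun z =>
               - ((m + c) * qc z + n * pc z + a)
               - pc z / (2 * nu) * pd ik H z) &
             dot J g (@kc R) (fun z =>
               (c - m) * pc z ^+ 2 + (c + m) * qc z ^+ 2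
               + 2 * n * pc z * qc z + pc z * b + qc z * a - H z)]))].
Proof.
move=> H phi psi ca cb c0 A B C.
have sd0 : Num.sqrt delta != 0 by rewrite gt_eqF // sqrtr_gt0.
have nu2 : 2 * nu != 0 by rewrite mulf_neq0 ?pnatr_eq0.
have Dh t : derivable h t 1 by exact: smooth_derivable.
have pdE i z : XJ1 z -> pd i H z = _ :=
  fun yz => pd_energy k nu a b c m n Dh i (lt0r_neq0 yz).
have cpdE i z : XJ1 z -> chart_pd phi psi i H z = _ :=
  fun yz => chart_pd_energy a b c m n Dh hk hnu i (lt0r_neq0 yz).
have o1 : lift ord0 ord0 = 1 :> 'I_2 by exact/val_inj.
have eqs z : XJ1 z ->
        [/\ A 0 z = yc z ^+ 2 * pd iy H z,
            A 1 z = pd ip H z - qc z * pd ik H z,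
            B 0 z = - k^-1 * pd ix H z,
            B 1 z = - (2 * nu)^-1 * (pd iq H z + pc z * pd ik H z) &
            C z = (2 * nu)^-1 * (pc z * pd ip H z + qc z * pd iq H z) - H z].
  move=> yz; rewrite /A /B /C /eomQ /eomP /eomK /reeb !big_ord_recl big_ord0 o1.
  rewrite /ca /cb /c0 /caJ /cbJ /c0J !cpdE // !pdE // /=.
  by split; field; rewrite ?sd0 ?hk ?hnu.
split=> //.
- exact: gtacos_J.
- by split; [exact: coordinates_J|exact: adapted_J].
move=> J g _ gJ.
(* the equations for (Q, P, kappa), rewritten as equations for (x, y, q, p, kappa) *)
have motionE : motion phi psi ca cb c0 H J g <->
    [/\ dot J g (@xc R) (fun z => A 0 z / k),
        dot J g (@yc R) (fun z => yc z ^+ 2 * B 0 z),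
        dot J g (@qc R) (fun z => A 1 z / (2 * nu)),
        dot J g (@pc R) (B 1) & dot J g (@kc R) C].
  have yJ t : J t -> yc (g t) != 0 by move=> /gJ yz; rewrite gt_eqF.
  have X := dot_scale J g (@xc R) (A 0) hk.
  have Y := @dot_Ninv _ _ J g (@yc R) (B 0) yJ.
  have Q := dot_scale J g (@qc R) (A 1) nu2.
  split=> [[/forall_I2[D1 D2] /forall_I2[D3 D4] D5]|[D1 D3 D2 D4 D5]].
    move: D1 D2 D3 D4 D5; rewrite !coord_phiJ => D1 D2 D3 D4 D5.
    by split=> //; [exact/X|exact/Y|exact/Q].
  split; [apply/forall_I2; split|apply/forall_I2; split|]; rewrite coord_phiJ //.
  - exact/X.
  - exact/Q.
  - exact/Y.
split; apply: (iff_trans motionE).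
  apply: eq_dot5 => t /gJ /eqs[-> -> -> -> ->].
  by split; field; rewrite ?hk ?hnu.
apply: eq_dot5 => t /gJ /[dup] /eqs[-> -> -> -> ->] yz.
have y0 : yc (g t) != 0 by rewrite gt_eqF.
rewrite !pdE //= /energy_x /energy_y /energy_q /energy_p.
by split; field; rewrite ?hk ?hnu ?y0.
Qed.
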